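(* Let $G$ be a finitely generated, torsion-free metabelian group whose abelianization $G/G'$ is torsion-free. Then $G$ is nilpotent if and only if $\mathcal{V}^1_1(G)\subseteq\{1\}$.
   Context: A group $G$ is metabelian if its second derived subgroup $G''$ is trivial, where $G'=(G,G)$ and $G''=(G',G')$. For a finitely generated group $G$, let $\mathbb{T}_G=\operatorname{Hom}(G,\mathbb{C}^* )$, with trivial character $1$; for $\rho\in\mathbb{T}_G$, $\mathbb{C}_\rho$ is the $G$-module $\mathbb{C}$ with $G$ acting through $\rho$. The first characteristic variety is $\mathcal{V}^1_1(G)=\{\rho\in\mathbb{T}_G\mid \dim_{\mathbb{C}}H^1(G,\mathbb{C}_\rho)\ge 1\}$. *)

(* Defs.v *)
From HB Require Import structures.
From mathcomp Require Import all_boot all_algebra generic_quotient ring_quotient.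
From mathcomp Require Import boolp classical_sets functions cardinality.

Set Implicit Arguments.
Unset Strict Implicit.
Unset Printing Implicit Defensive.

Import GRing.Theory.
Local Open Scope classical_set_scope.
Local Open Scope quotient_scope.
Local Open Scope group_scope.

Section Subgroups.
Variable G : groupType.
Implicit Types (A B H : set G) (x y : G).

Definition is_subgroup H :=
  [/\ H 1, forall x y, H x -> H y -> H (x * y) & forall x, H x -> H x^-1].

Definition generated A : set G := smallest is_subgroup A.

(* The subgroup (A, B); MathComp's [~ x, y] is x^-1 y^-1 x y, and the other
   convention x y x^-1 y^-1 generates the same subgroup. *)
Definition commutator A B : set G :=
  generated [set [~ x, y] | x in A & y in B].

Lemma generated_subgroup A : is_subgroup (generated A).
Proof.
split=> [|x y Hx Hy|x Hx] H [sgH AH]; have [H1 HM HV] := sgH => //.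
- by apply: HM; [apply: Hx | apply: Hy].
- by apply: HV; apply: Hx.
Qed.

Lemma commutatorTT_normal x y :
  commutator setT setT x -> commutator setT setT (x ^ y).
Proof.
have [_ HM _] := generated_subgroup [set [~ a, b] | a in setT & b in setT].
move=> Hx; have -> : x ^ y = x * [~ x, y] by rewrite /commg mulVKg.
by apply: HM => //; apply: sub_gen_smallest; exists x => //; exists y.
Qed.

End Subgroups.

Record normal_subgroup (G : groupType) := NormalSubgroup {
  normal_set : set G;
  normal_is_subgroup : is_subgroup normal_set;
  normal_conj : forall x y, normal_set x -> normal_set (x ^ y) }.

Section QuotientGroup.
Variables (G : groupType) (N : normal_subgroup G).

Definition coset_equiv (x y : G) : bool := `[< normal_set N (x^-1 * y) >].

Lemma coset_equivP x y : reflect (normal_set N (x^-1 * y)) (coset_equiv x y).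
Proof. exact: asboolP. Qed.

Lemma coset_equiv_is_equiv : equiv_class_of coset_equiv.
Proof.
have [N1 NM NV] := normal_is_subgroup N.
split=> [x|x y|y x z].
- by apply/coset_equivP; rewrite mulVg.
- by apply/coset_equivP/coset_equivP => /NV; rewrite invgM invgK.
- move=> /coset_equivP xy /coset_equivP yz; apply/coset_equivP.
  by have := NM _ _ xy yz; rewrite mulgA mulgK.
Qed.

Canonical coset_equiv_equiv := EquivRelPack coset_equiv_is_equiv.
Canonical coset_equiv_encModRel := defaultEncModRel coset_equiv.

Definition quotient_group := {eq_quot coset_equiv}.

HB.instance Definition _ : EqQuotient G coset_equiv quotient_group :=
  EqQuotient.on quotient_group.
HB.instance Definition _ := Choice.on quotient_group.

Lemma coset_eqP x y : reflect (normal_set N (x^-1 * y)) (x == y %[mod quotient_group]).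
Proof. by rewrite piE; exact: coset_equivP. Qed.

Definition coset_one : quotient_group := lift_cst quotient_group 1.
Definition coset_mul := lift_op2 quotient_group (fun x y : G => x * y).
Definition coset_inv := lift_op1 quotient_group (fun x : G => x^-1).

Canonical pi_coset_one := PiConst coset_one.

Lemma pi_coset_mulP : {morph \pi_quotient_group : x y / x * y >-> coset_mul x y}.
Proof.
have [N1 NM NV] := normal_is_subgroup N.
move=> x y /=; unlock coset_mul; apply/eqP/coset_eqP.
set x' := repr _; set y' := repr _.
have Nx : normal_set N (x^-1 * x') by apply/coset_eqP; rewrite reprK.
have Ny : normal_set N (y^-1 * y') by apply/coset_eqP; rewrite reprK.
have := NM _ _ (normal_conj y Nx) Ny.
by rewrite /conjg invgM !mulgA mulgK.
Qed.
Canonical pi_coset_mul := PiMorph2 pi_coset_mulP.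

Lemma pi_coset_invP : {morph \pi_quotient_group : x / x^-1 >-> coset_inv x}.
Proof.
have [N1 NM NV] := normal_is_subgroup N.
move=> x /=; unlock coset_inv; apply/eqP/coset_eqP.
set x' := repr _.
have Nx : normal_set N (x'^-1 * x) by apply/coset_eqP; rewrite reprK.
have := normal_conj x'^-1 Nx.
by rewrite /conjg !invgK !mulgA mulgV mul1g.
Qed.
Canonical pi_coset_inv := PiMorph1 pi_coset_invP.

Lemma coset_mulA : associative coset_mul.
Proof. by move=> x y z; rewrite -[x]reprK -[y]reprK -[z]reprK !piE mulgA. Qed.

Lemma coset_mul1 : left_id coset_one coset_mul.
Proof. by move=> x; rewrite -[x]reprK !piE mul1g. Qed.

Lemma coset_mulr1 : right_id coset_one coset_mul.
Proof. by move=> x; rewrite -[x]reprK !piE mulg1. Qed.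

Lemma coset_mulV : left_inverse coset_one coset_inv coset_mul.
Proof. by move=> x; rewrite -[x]reprK !piE mulVg. Qed.

Lemma coset_mulrV : right_inverse coset_one coset_inv coset_mul.
Proof. by move=> x; rewrite -[x]reprK !piE mulgV. Qed.

HB.instance Definition _ := isGroup.Build quotient_group
  coset_mulA coset_mul1 coset_mulr1 coset_mulV coset_mulrV.

End QuotientGroup.

Section GroupProperties.
Variable G : groupType.

Definition derived : set G := commutator [set: G] [set: G].
Definition derived2 : set G := commutator derived derived.

Definition derived_normal : normal_subgroup G :=
  NormalSubgroup (generated_subgroup _) (@commutatorTT_normal G).

Definition abelianization : groupType := quotient_group derived_normal.

Definition finitely_generated :=
  exists2 S : set G, finite_set S & generated S = [set: G].

Definition torsion_free := forall (x : G) n, (0 < n)%N -> x ^+ n = 1 -> x = 1.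

Definition metabelian := derived2 = [set 1].

Definition lower_central (n : nat) : set G :=
  iter n (fun H => commutator H [set: G]) [set: G].

Definition nilpotent := exists n, lower_central n = [set 1].

End GroupProperties.

Local Open Scope ring_scope.

Section MultiplicativeGroup.
Variable K : fieldType.

Definition mulgroup := {z : K | z != 0}.
HB.instance Definition _ := Choice.on mulgroup.

Definition mulgroup_one : mulgroup := Sub 1 (oner_neq0 K).

Lemma mulgroup_mul_proof (a b : mulgroup) : val a * val b != 0.
Proof. exact: mulf_neq0 (valP a) (valP b). Qed.
Definition mulgroup_mul (a b : mulgroup) : mulgroup :=
  Sub (val a * val b) (mulgroup_mul_proof a b).

Lemma mulgroup_inv_proof (a : mulgroup) : (val a)^-1 != 0.
Proof. by rewrite invr_neq0 ?(valP a). Qed.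
Definition mulgroup_inv (a : mulgroup) : mulgroup :=
  Sub (val a)^-1 (mulgroup_inv_proof a).

Lemma mulgroup_mulA : associative mulgroup_mul.
Proof. by move=> a b c; apply: val_inj; rewrite /= mulrA. Qed.

Lemma mulgroup_mul1 : left_id mulgroup_one mulgroup_mul.
Proof. by move=> a; apply: val_inj; rewrite /= mul1r. Qed.

Lemma mulgroup_mulr1 : right_id mulgroup_one mulgroup_mul.
Proof. by move=> a; apply: val_inj; rewrite /= mulr1. Qed.

Lemma mulgroup_mulV : left_inverse mulgroup_one mulgroup_inv mulgroup_mul.
Proof. by move=> a; apply: val_inj; rewrite /= mulVf ?(valP a). Qed.

Lemma mulgroup_mulrV : right_inverse mulgroup_one mulgroup_inv mulgroup_mul.
Proof. by move=> a; apply: val_inj; rewrite /= divff ?(valP a). Qed.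

HB.instance Definition _ := isGroup.Build mulgroup
  mulgroup_mulA mulgroup_mul1 mulgroup_mulr1 mulgroup_mulV mulgroup_mulrV.

End MultiplicativeGroup.

Section QuotientModule.
Variables (K : fieldType) (V : lmodType K) (W : submodClosed V).

(* MathComp's submodClosed does not inherit from zmodClosed. *)
Definition submod_pred : {pred V} := fun v => v \in W.

Lemma submod_pred_closed : submod_closed submod_pred.
Proof.
by split=> [|a u v Wu Wv]; rewrite unfold_in ?rpred0 // rpredD // rpredZ.
Qed.
HB.instance Definition _ := GRing.isSubmodClosed.Build K V submod_pred
  submod_pred_closed.

Definition quotient_module := Quotient.quot submod_pred.
HB.instance Definition _ :
    EqQuotient V (Quotient.equiv submod_pred) quotient_module :=
  EqQuotient.on quotient_module.
HB.instance Definition _ := GRing.Zmodule.on quotient_module.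

Lemma pi_quotient_addP : {morph \pi_quotient_module : u v / u + v}.
Proof. exact: Quotient.pi_add. Qed.

Lemma quotient_module_eqP u v :
  reflect (u = v %[mod quotient_module]) (u - v \in W).
Proof.
have -> : (u - v \in W) = (u == v %[mod quotient_module]).
  by rewrite -Quotient.idealrBE.
exact: eqP.
Qed.

Definition quot_scale (a : K) (u : quotient_module) : quotient_module :=
  \pi_quotient_module (a *: repr u).

Lemma pi_quot_scale a v :
  quot_scale a (\pi_quotient_module v) = \pi_quotient_module (a *: v).
Proof.
apply/quotient_module_eqP; rewrite -scalerBr rpredZ //.
by apply/quotient_module_eqP; rewrite reprK.
Qed.

Lemma quot_scaleA a b u : quot_scale a (quot_scale b u) = quot_scale (a * b) u.
Proof.
by elim/quotW: u => v; rewrite (pi_quot_scale b) !pi_quot_scale scalerA.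
Qed.

Lemma quot_scale1 : left_id 1 quot_scale.
Proof. by move=> u; rewrite -[u]reprK pi_quot_scale scale1r. Qed.

Lemma quot_scaleDr : right_distributive quot_scale +%R.
Proof.
move=> a u v; rewrite -[u]reprK -[v]reprK.
by rewrite -pi_quotient_addP !pi_quot_scale -pi_quotient_addP scalerDr.
Qed.

Lemma quot_scaleDl u : {morph quot_scale^~ u : a b / a + b}.
Proof.
move=> a b /=; rewrite -[u]reprK !pi_quot_scale.
by rewrite -pi_quotient_addP scalerDl.
Qed.

HB.instance Definition _ := GRing.Zmodule_isLmodule.Build K quotient_module
  quot_scaleA quot_scale1 quot_scaleDr quot_scaleDl.

End QuotientModule.

(* d <= dim_K V, for V possibly of infinite dimension. *)
Definition dim_ge (K : fieldType) (V : lmodType K) (d : nat) :=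
  exists v : 'I_d -> V, forall a : 'I_d -> K,
    \sum_(i < d) a i *: v i = 0 -> forall i, a i = 0.

Definition character (G : groupType) (K : fieldType) :=
  {multiplicative G -> mulgroup K}.

Section Cohomology.
Variables (G : groupType) (K : fieldType) (rho : character G K).

(* K_rho, i.e. K with g acting as multiplication by rho g. *)
Definition rho_act (g : G) (z : K^o) : K^o := val (rho g) * z.

Definition cocycle : {pred G -> K^o} := fun f : G -> K^o =>
  `[< forall g h : G, f (g * h)%g = f g + rho_act g (f h) >].

Lemma cocycle_submod : submod_closed cocycle.
Proof.
split=> [|a f1 f2 /asboolP Hf1 /asboolP Hf2]; apply/asboolP => g h.
  by rewrite /rho_act mulr0 addr0.
rewrite /rho_act /= in Hf1 Hf2 *.
rewrite !fctE Hf1 Hf2 /GRing.scale /= !mulrDr addrACA.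
by congr (_ + (_ + _)); rewrite mulrCA.
Qed.
HB.instance Definition _ := GRing.isSubmodClosed.Build K (G -> K^o) cocycle
  cocycle_submod.

Definition Z1 := {f : G -> K^o | f \in cocycle}.
HB.instance Definition _ := SubChoice.on Z1.
HB.instance Definition _ := [SubChoice_isSubLmodule of Z1 by <:].

Definition coboundary : {pred Z1} := fun f : Z1 =>
  `[< exists z : K^o, forall g : G, val f g = rho_act g z - z >].

Lemma coboundary_submod : submod_closed coboundary.
Proof.
split=> [|a f1 f2 /asboolP[z1 Hz1] /asboolP[z2 Hz2]]; apply/asboolP.
  by exists 0 => g; rewrite /rho_act mulr0 subrr.
exists (a *: z1 + z2) => g.
rewrite linearP !fctE /= Hz1 Hz2 /rho_act /GRing.scale /=.
by rewrite mulrBr mulrDr opprD addrACA mulrCA.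
Qed.
HB.instance Definition _ := GRing.isSubmodClosed.Build K Z1 coboundary
  coboundary_submod.

Definition H1 : lmodType K := quotient_module coboundary.

End Cohomology.
Arguments cocycle {G K} rho _.
Arguments coboundary {G K} rho _.

(* V^1_d(G), with coefficients in K. *)
Definition charvar1 (G : groupType) (K : fieldType) (d : nat) :
    set (character G K) :=
  [set rho | dim_ge (H1 rho) d].
Arguments charvar1 : clear implicits.

Definition trivial_character (G : groupType) (K : fieldType) : character G K :=
  @one_fun G (mulgroup K).
Arguments trivial_character : clear implicits.

(* Main.v *)
From HB Require Import structures.
Require Import Defs.
From mathcomp Require Import all_boot all_algebra generic_quotient.
From mathcomp Require Import boolp classical_sets cardinality reals complex.

(* For a nilpotent group, a cocycle f with coefficients in C_rho satisfies
   f [x, g] = (rho(g)^-1 - 1) f x on G', so it vanishes on G' by descent along the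
   lower central series once rho(g) <> 1; a cocycle vanishing on G' is a coboundary.

   Conversely, G' is a finitely generated module over Z[G/G'], hence over a polynomial
   ring R over Z. If G is not nilpotent, some generator g acts on G' with b = g - 1 not
   nilpotent. As G' is torsion-free, inverting b and the positive integers leaves a
   nonzero finitely generated module, hence a nonzero cyclic quotient, and the
   Nullstellensatz for R gives a point chi : R -> C of its support with chi b <> 0: a
   nonzero additive phi : G' -> C on which G acts through a character rho with
   rho(g) <> 1. Then h |-> phi (g h g^-1 h^-1) is a cocycle for rho that is nonzero
   on G', so not a coboundary. *)

Set Implicit Arguments.
Unset Strict Implicit.
Unset Printing Implicit Defensive.

Import GRing.Theory Pdiv.Ring Pdiv.ComRing.
Local Open Scope classical_set_scope.
Local Open Scope ring_scope.

(** * A Nullstellensatz for polynomial rings over Z *)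

Section PrimeIdeals.
Variable R : comNzRingType.

Definition ideal (P : set R) :=
  [/\ P 0, forall a b, P a -> P b -> P (a + b) & forall a b, P b -> P (a * b)].

Definition prime_ideal (P : set R) :=
  [/\ ideal P, ~ P 1 & forall a b, P (a * b) -> P a \/ P b].

Lemma idealB (P : set R) a b : ideal P -> P a -> P b -> P (a - b).
Proof. by move=> [_ PD PM] Pa Pb; apply: PD => //; rewrite -mulN1r; apply: PM. Qed.

Lemma prime_idealX (P : set R) a n : prime_ideal P -> P (a ^+ n) -> P a.
Proof.
move=> [_ P1 PM]; elim: n => [|n IHn]; first by rewrite expr0 => /P1.
by rewrite exprS => /PM[].
Qed.

End PrimeIdeals.

(** The Nullstellensatz for [R]: a prime of residue characteristic zero is the intersection of the
    kernels of the morphisms to [K] that vanish on it. In this form it passes from [R] to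
    [{poly R}]. *)
Definition separating (K : closedFieldType) (R : comNzRingType) :=
  forall P : set R, prime_ideal P -> (forall n, ~ P n.+1%:R) ->
  forall b, ~ P b ->
  exists2 chi : {rmorphism R -> K}, forall p, P p -> chi p = 0 & chi b != 0.

(** A prime of Z without positive integers is zero, and Z embeds in [K]. *)
Lemma separating_int (K : closedFieldType) :
  [pchar K] =i pred0 -> separating K int.
Proof.
move=> K0 P [[P0 PD PM] _ _] Pn.
have P_eq0 p : P p -> p = 0.
  case: p => [[|n]|n] // Pp; first by case: (Pn n); rewrite natz.
  by case: (Pn n); rewrite -[_%:R]opprK natz -NegzE -mulN1r; apply: PM.
move=> b nPb; exists (intmul 1) => [p /P_eq0 -> //|].
have: b != 0 by apply/eqP => b0; apply: nPb; rewrite b0.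
case: b {nPb} => n n0; last rewrite NegzE rmorphN oppr_eq0.
  by rewrite /= ?pmulrn (pcharf0P K).1.
by rewrite /= ?pmulrn (pcharf0P K).1.
Qed.

Lemma size_sub_top (R : nzRingType) (p : {poly R}) n :
  (size p <= n.+1)%N -> (size (p - p`_n *: 'X^n)%R <= n)%N.
Proof.
move=> sp; apply/leq_sizeP => j; rewrite coefB coefZ coefXn leq_eqVlt.
case/predU1P => [<-|lt_j]; first by rewrite eqxx mulr1 subrr.
by rewrite (gtn_eqF lt_j) mulr0 subr0 nth_default // (leq_trans sp).
Qed.

Section Polynomials.
Variables (R : comNzRingType) (P : set {poly R}).
Hypothesis primeP : prime_ideal P.

Let P0 : set R := [set a | P a%:P].
Let coefsP (p : {poly R}) := forall i, P0 p`_i.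

Lemma prime_ideal_polyC : prime_ideal P0.
Proof.
have [[Pz PD PM] P1 Pprime] := primeP; split=> //.
- split=> [|a b Pa Pb|a b Pb]; rewrite /P0 /= ?polyC0 // ?polyCD ?polyCM.
    exact: PD.
  exact: PM.
- by move=> a b; rewrite /P0 /= polyCM => /Pprime.
Qed.

Lemma coefs_in_ideal p : coefsP p -> P p.
Proof.
have [[Pz PD PM] _ _] := primeP.
move=> cP; rewrite -[p]coefK poly_def.
by elim/big_ind: _ => // i _; rewrite -mul_polyC mulrC; apply: PM; apply: cP.
Qed.

(* [D] stands for [P] minus the extension of [P0], or for [(b) + P] minus [P]. *)
Lemma min_size_lead (D : set {poly R}) w0 :
    (forall w, D w -> ~ coefsP w) ->
    (forall w v, D w -> coefsP v -> D (w - v)) -> D w0 ->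
  exists w, [/\ D w, ~ P0 (lead_coef w) &
    forall v, D v -> (size w <= size v)%N].
Proof.
move=> Dcoefs DB Dw0.
have [[P00 _ _] _ _] := prime_ideal_polyC.
have exD : exists n, `[< exists2 w, D w & size w = n >].
  by exists (size w0); apply/asboolP; exists w0.
case: (ex_minnP exD) => n /asboolP[w Dw sw] min_n.
have min_w v : D v -> (size w <= size v)%N.
  by move=> Dv; rewrite sw; apply: min_n; apply/asboolP; exists v.
exists w; split=> // Plw.
have w_neq0 : w != 0.
  by apply/eqP => w0'; apply: (Dcoefs w) => // i; rewrite w0' coef0.
(* Removing a leading term with coefficient in [P0] would give a smaller element of [D]. *)
pose v : {poly R} := w - lead_coef w *: 'X^((size w).-1).
have Dv : D v.
  apply: DB => // i; rewrite coefZ coefXn; case: eqP => _; last by rewrite mulr0.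
  by rewrite mulr1.
have lt_v : (size v < size w)%N.
  move: w_neq0; rewrite /v /lead_coef -size_poly_gt0.
  by case e: (size w) => [//|k] _; rewrite ltnS; apply: size_sub_top; rewrite e.
by move: (min_w _ Dv); rewrite leqNgt lt_v.
Qed.

End Polynomials.

(* Over the fraction field of [R / P0], with [P0] the trace of [P] on [R], the prime
   [P] is either zero or generated by a polynomial [q] of minimal size. In the second
   case [b] divides some [a] of [R] outside [P0] modulo [P], and it suffices to map [a]
   and the leading coefficient of [q] to nonzero elements and ['X] to a root of [q]. *)
Lemma separating_poly (K : closedFieldType) (R : comNzRingType) :
  separating K R -> separating K {poly R}.
Proof.
move=> sepR P primeP Pn b nPb.
have [idP P1 Pprime] := primeP; have [P_0 PD PM] := idP.
pose P0 : set R := [set a | P a%:P].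
pose coefsP (p : {poly R}) := forall i, P0 p`_i.
have primeP0 : prime_ideal P0 := prime_ideal_polyC primeP.
have [[P00 P0D P0M] _ P0prime] := primeP0.
have P0n n : ~ P0 n.+1%:R by rewrite /P0 /= polyCMn polyC1; exact: Pn.
have ext p : coefsP p -> P p := coefs_in_ideal primeP (p := p).
pose ev (sigma : {rmorphism R -> K}) c : {rmorphism {poly R} -> K} :=
  horner_morph ((fun x => mulrC c (sigma x)) : commr_rmorph sigma c).
have evC sigma c a : ev sigma c a%:P = sigma a by exact: horner_morphC.
(* If [P] is the extension of [P0], then ['X] can go to any non-root of the image of [b]. *)
case: (pselect (P `<=` [set p | coefsP p])) => [sPc|].
  have [i nbi] : exists i, ~ P0 b`_i.
    by apply/existsNP => cb; apply: nPb; apply: ext.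
  have [sigma sigma0 sigma_b] := sepR _ primeP0 P0n _ nbi.
  have mb0 : map_poly sigma b != 0.
    by apply: contraNneq sigma_b => mb0; rewrite -coef_map mb0 coef0.
  have [c nroot] := elimT (closed_nonrootP _) mb0.
  exists (ev sigma c) => [p /sPc cp|]; last exact: nroot.
  rewrite /= /horner_morph.
  suff -> : map_poly sigma p = 0 by rewrite horner0.
  by apply/polyP => j; rewrite coef_map coef0 /= sigma0.
move=> /existsNP[q0 /not_implyP[Pq0 ncq0]].
have [] := @min_size_lead _ _ primeP [set q | P q /\ ~ coefsP q] q0 => //.
- by move=> w [].
- move=> w v [Pw ncw] cv; split; first by apply: idealB => //; apply: ext.
  apply: contra_not ncw => cwv i; rewrite -[w](subrK v) coefD.
  by apply: P0D; [apply: cwv | apply: cv].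
move=> q [[Pq ncq] nlq min_q].
have q_neq0 : q != 0.
  by apply/eqP => q0'; apply: ncq; rewrite q0' => i; rewrite coef0.
(* Removing the term of degree [(size q).-1] from [r] leaves an element of [P] smaller than [q]. *)
have small' r : P r -> (size r <= size q)%N -> P0 r`_(size q).-1 -> coefsP r.
  move=> Pr ler Plr.
  pose v : {poly R} := r`_(size q).-1 *: 'X^((size q).-1).
  have cv : coefsP v.
    move=> i; rewrite coefZ coefXn; case: eqP => _; last by rewrite mulr0.
    by rewrite mulr1.
  apply: contrapT => ncr.
  have : (size q <= size (r - v)%R)%N.
    apply: min_q; split; first by apply: idealB => //; apply: ext.
    apply: contra_not ncr => crv i; rewrite -[r](subrK v) coefD.
    by apply: P0D; [apply: crv | apply: cv].
  rewrite leqNgt => /negP; apply.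
  move: q_neq0 ler; rewrite /v -size_poly_gt0.
  by case: (size q) => [//|n] _ ler; rewrite ltnS; apply: size_sub_top.
have small r : P r -> (size r < size q)%N -> coefsP r.
  move=> Pr ltr; apply: small' => //; first exact: ltnW.
  by rewrite nth_default // -ltnS prednK ?size_poly_gt0.
(* [I] is the ideal (b) + P; the aim is a constant of [I] outside [P0]. *)
pose I : set {poly R} := [set w | exists u, P (u * b - w)].
have Ib : I b by exists 1; rewrite mul1r subrr.
have ID w v : I w -> I v -> I (w + v).
  move=> [u Pu] [t Pt]; exists (u + t).
  by rewrite mulrDl opprD addrACA; apply: PD.
have IM w v : I v -> I (w * v).
  by move=> [u Pu]; exists (w * u); rewrite -mulrA -mulrBr; apply: PM.
have IP w : P w -> I w.
  by move=> Pw; exists 0; rewrite mul0r; apply: idealB.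
have [] := @min_size_lead _ _ primeP [set w | I w /\ ~ P w] b => //.
- by move=> w [_ nPw]; apply: contra_not nPw; apply: ext.
- move=> w v [Iw nPw] /ext Pv; split.
    by rewrite -mulN1r; apply: ID => //; apply: IM; apply: IP.
  by apply: contra_not nPw => Pwv; rewrite -[w](subrK v); apply: PD.
move=> w [[Iw nPw] nlw min_w].
have Plead p r k : ~ P0 (lead_coef p) -> P (lead_coef p ^+ k *: r) -> P r.
  move=> nlp; rewrite -mul_polyC => /Pprime[] // Plp; case: nlp.
  exact: prime_idealX Plp.
have [a nPa [u Pu]] : exists2 a, ~ P0 a & I a%:P.
  suff sw : (size w <= 1)%N.
    by exists w`_0; rewrite /P0 /= -(size1_polyC sw).
  rewrite leqNgt; apply/negP => sw.
  have w_neq0 : w != 0 by rewrite -size_poly_gt0 ltnW.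
  (* The pseudo-remainder of [w] by [q] is in [I] but not in [P], so it is at least as large as [w],
     while smaller than [q]. *)
  have ltwq : (size w < size q)%N.
    have Er := rdivp_eq q w; have := ltn_rmodpN0 w q_neq0.
    apply: leq_ltn_trans; apply: min_w; split.
      rewrite -[rmodp w q](addKr (rdivp w q * q)) -Er -mulNr addrC.
      apply: ID; last by apply: IP; apply: PM.
      by rewrite -mul_polyC; apply: IM.
    move=> Pr; apply: nPw; apply: (Plead q _ (rscalp w q)) => //.
    by rewrite Er; apply: PD => //; apply: PM.
  (* Dividing [q] by [w] leaves a remainder in [P], hence with coefficients in [P0]. The quotient
     [h] turns out to have the same property, which contradicts that the leading coefficients of [w]
     and [q] are outside [P0]. *)
  have Er := rdivp_eq w q; have ltr := ltn_rmodpN0 q w_neq0.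
  set h := rdivp q w in Er; set r := rmodp q w in Er ltr.
  have Pr : P r.
    apply/notP => nPr; move: ltr; rewrite ltnNge => /negP; apply.
    apply: min_w; split=> //.
    rewrite -[r](addKr (h * w)) -Er -mulNr addrC.
    apply: ID; last by apply: IM.
    by apply: IP; rewrite -mul_polyC; apply: PM.
  have cr : coefsP r by apply: small => //; apply: ltn_trans ltwq.
  have Ph : P h.
    have /Pprime[] // : P (h * w).
    by rewrite -[h * w](addrK r) -Er; apply: idealB => //; rewrite -mul_polyC; apply: PM.
  have ch : coefsP h.
    have leh : (size h <= size q)%N by exact: leq_rdivp.
    apply: small' => //; move: leh; rewrite leq_eqVlt => /orP[/eqP sh|lth].
      (* As [w] is not constant, the leading term of [h * w] would lie beyond the degrees of [q] and
         [r], so its coefficient is zero. *)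
      suff /P0prime[|//] : P0 (lead_coef h * lead_coef w) by rewrite /lead_coef sh.
      rewrite mul_lead_coef -[h * w](addrK r) -Er coefB coefZ sh.
      have leq_i : (size q <= (size q + size w).-2)%N.
        by case: (size w) sw => [|[|k]] // _; rewrite !addnS leq_addr.
      rewrite !nth_default ?mulr0 ?subrr //.
      exact: leq_trans (ltnW (ltn_trans ltr ltwq)) leq_i.
    by rewrite nth_default // -ltnS prednK ?size_poly_gt0.
  have: P0 ((lead_coef w ^+ rscalp q w *: q)`_(size q).-1).
    rewrite Er coefD; apply: (P0D) => //; rewrite coefM.
    by apply: (big_ind P0 P00 P0D) => i _; rewrite mulrC; apply: P0M.
  rewrite coefZ => /P0prime[] //.
  by move=> /(prime_idealX primeP0).
have [sigma sigma0] : exists2 sigma : {rmorphism R -> K},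
    forall p, P0 p -> sigma p = 0 & sigma (lead_coef q * a) != 0.
  by apply: sepR => // /P0prime[].
rewrite rmorphM mulf_eq0 negb_or => /andP[lq_neq0 a_neq0].
(* The leading coefficient of [q] survives under [sigma], and [q] is not constant, since a constant
   of [P] lies in [P0]. So the image of [q] has a root. *)
have smq : size (map_poly sigma q) = size q by apply: size_map_poly_id0.
have [c /rootP rc] : exists c, root (map_poly sigma q) c.
  apply/closed_rootP; rewrite smq; apply/negP => /size_poly1P[x x0 qx].
  by apply: nlq; rewrite qx lead_coefC /P0 /= -qx.
have ev0 p : P p -> ev sigma c p = 0.
  move=> Pp.
  have Er := rdivp_eq q p; have ltr := ltn_rmodpN0 p q_neq0.
  set h := rdivp p q in Er; set r := rmodp p q in Er ltr.
  have cr : coefsP r.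
    apply: small ltr.
    rewrite -[r](addKr (h * q)) -Er addrC; apply: idealB => //; last exact: PM.
    by rewrite -mul_polyC; apply: PM.
  have er : ev sigma c r = 0.
    rewrite /= /horner_morph.
    suff -> : map_poly sigma r = 0 by rewrite horner0.
    by apply/polyP => j; rewrite coef_map coef0 /= sigma0.
  move/(congr1 (ev sigma c)): Er; rewrite rmorphD rmorphM er addr0.
  have -> : ev sigma c q = 0 by exact: rc.
  rewrite mulr0 -mul_polyC rmorphM evC rmorphXn => /eqP.
  by rewrite mulf_eq0 expf_eq0 (negPf lq_neq0) andbF => /eqP.
exists (ev sigma c) => //; apply: contraNneq a_neq0 => eb.
have /eqP := ev0 _ Pu.
by rewrite rmorphB rmorphM eb mulr0 evC sub0r oppr_eq0.
Qed.

(** An ideal that is maximal among those containing [J] and disjoint from [S] is prime. *)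
Lemma prime_avoiding (R : comNzRingType) (S J : set R) :
    S 1 -> (forall a b, S a -> S b -> S (a * b)) ->
    ideal J -> (forall s, S s -> ~ J s) ->
  exists P, [/\ prime_ideal P, J `<=` P & forall s, S s -> ~ P s].
Proof.
move=> S1 SM idJ disjJ.
(* Taking the union with [J] makes the empty chain admissible for Zorn. *)
pose good (X : set R) := ideal (X `|` J) /\ forall s, S s -> ~ (X `|` J) s.
have [F Fgood totF|X [[idX disjX] maxX]] := @Zorn_bigcup _ good.
  have [[J0 JD JM] sF] : ideal J /\ forall X, F X -> X `<=` \bigcup_(X in F) X.
    by split=> // X FX; exact: bigcup_sup.
  have inU X : F X -> X `|` J `<=` (\bigcup_(X in F) X) `|` J.
    by move=> FX; apply: setSU; exact: sF.
  split; last first.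
    move=> s Ss [[X FX Xs]|]; last exact: disjJ.
    by have [_ /(_ s Ss)] := Fgood _ FX; apply; left.
  split; first by right.
    move=> a b [[X FX Xa]|Ja] [[Y FY Yb]|Jb].
    - have [sXY|sYX] := totF _ _ FX FY.
        have [[_ YD _] _] := Fgood _ FY; apply: (inU _ FY); apply: YD; left => //.
        exact: sXY.
      have [[_ XD _] _] := Fgood _ FX; apply: (inU _ FX); apply: XD; left => //.
      exact: sYX.
    - have [[_ XD _] _] := Fgood _ FX; apply: (inU _ FX).
      by apply: XD; [left | right].
    - have [[_ YD _] _] := Fgood _ FY; apply: (inU _ FY).
      by apply: YD; [right | left].
    - by right; apply: JD.
  move=> a b [[X FX Xb]|Jb]; last by right; apply: JM.
  by have [[_ _ XM] _] := Fgood _ FX; apply: (inU _ FX); apply: XM; left.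
set P := X `|` J in idX disjX *; exists P; split=> //; last by right.
have [P0 PD PM] := idX.
split=> //; first exact: disjX.
pose adjoin a : set R := [set x | exists2 p, P p & exists r, x = p + r * a].
have hit a : ~ P a -> exists2 s, S s & adjoin a s.
  move=> nPa; apply: contrapT => /forall2NP nhit.
  have sP : P `<=` adjoin a by move=> p Pp; exists p => //; exists 0; rewrite mul0r addr0.
  have eqU : adjoin a `|` J = adjoin a.
    by apply: setUidl => j Jj; apply: sP; right.
  apply: (maxX (adjoin a)); last first.
    rewrite /good eqU; split; last by move=> s Ss; case: (nhit s).
    split; first exact: sP.
      move=> _ _ [p Pp [r ->]] [q Pq [t ->]]; exists (p + q); first exact: PD.
      by exists (r + t); rewrite mulrDl addrACA.
    move=> c _ [p Pp [r ->]]; exists (c * p); first exact: PM.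
    by exists (c * r); rewrite mulrDr mulrA.
  split; first by move=> x Xx; apply: sP; left.
  move=> /(_ a) sub; apply: nPa; left; apply: sub.
  by exists 0 => //; exists 1; rewrite mul1r add0r.
(* Elements of [S] in P + (a) and in P + (b) have their product in P + (ab), that is, in [P]. *)
move=> a b Pab; apply: contrapT => /not_orP[/hit[s Ss [p Pp [r Es]]]].
move=> /hit[t St [q Pq [u Et]]]; apply: (disjX (s * t)); first exact: SM.
rewrite Es Et mulrDl !mulrDr addrA.
apply: (PD); last by rewrite mulrACA; apply: PM.
apply: (PD); last by apply: PM.
apply: (PD); first by apply: PM.
by rewrite mulrC; apply: PM.
Qed.

(** * Modules and eigenfunctionals *)

Section Submodules.
Variables (R : comNzRingType) (V : lmodType R).

Definition submodule (W : set V) :=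
  [/\ W 0, forall x y, W x -> W y -> W (x + y) & forall a x, W x -> W (a *: x)].

Fixpoint span (gens : seq V) : set V :=
  if gens is m :: gens' then [set x | exists a, span gens' (x - a *: m)]
  else [set 0].

Lemma span_submodule gens : submodule (span gens).
Proof.
elim: gens => [|m gens [W0 WD WZ]] /=.
  split=> [|x y -> ->|a x ->] //=; first by rewrite addr0.
  by rewrite scaler0.
split; first by exists 0; rewrite scale0r subrr.
  move=> x y [a Wa] [b Wb]; exists (a + b).
  by rewrite scalerDl opprD addrACA; apply: WD.
by move=> c x [a Wa]; exists (c * a); rewrite -scalerA -scalerBr; apply: WZ.
Qed.

Lemma mem_span gens x : x \in gens -> span gens x.
Proof.
elim: gens => //= m gens IHg; rewrite inE => /predU1P[->|/IHg xg].
  exists 1; rewrite scale1r subrr.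
  by have [] := span_submodule gens.
by exists 0; rewrite scale0r subr0.
Qed.

Lemma submoduleB W x y : submodule W -> W x -> W y -> W (x - y).
Proof. by move=> [_ WD WZ] Wx Wy; apply: WD => //; rewrite -scaleN1r; apply: WZ. Qed.

(* [V / W] is, after inverting [S], cyclic and nonzero. *)
Lemma cyclic_quotient (S : set R) gens :
    S 1 -> (forall a b, S a -> S b -> S (a * b)) ->
    (forall x, exists2 s, S s & span gens (s *: x)) ->
    ~ (forall x : V, exists2 s, S s & s *: x = 0) ->
  exists m, exists W : set V,
    [/\ submodule W, forall s x, S s -> W (s *: x) -> W x, ~ W m &
        forall x, exists s, exists2 a, S s & W (s *: x - a *: m)].
Proof.
move=> S1 SM; elim: gens => [//|m gens IHg] genV ntorsV.
have [W0 WD WZ] := span_submodule gens.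
(* The saturation by [S] of the span of the remaining generators. If it contains [m], these generate
   [V] up to [S]; otherwise [m] generates a nonzero quotient. *)
pose W : set V := [set x | exists2 s, S s & span gens (s *: x)].
have [Wm|nWm] := pselect (W m).
  apply: IHg => // x; have [s Ss [a Wa]] := genV x; have [t St Wt] := Wm.
  exists (t * s); first exact: SM.
  rewrite -[(t * s) *: x](subrK ((t * a) *: m)) -!scalerA -scalerBr.
  apply: (WD); first exact: WZ.
  by rewrite scalerA mulrC -scalerA; apply: WZ.
exists m, W; split=> //.
- split; first by exists 1; rewrite ?scaler0.
    move=> x y [s Ss Wx] [t St Wy]; exists (s * t); first exact: SM.
    rewrite scalerDr; apply: WD; last by rewrite -scalerA; apply: WZ.
    by rewrite mulrC -scalerA; apply: WZ.
  move=> a x [s Ss Wx]; exists s => //.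
  by rewrite scalerA mulrC -scalerA; apply: WZ.
- move=> s x Ss [t St Wx]; exists (t * s); first exact: SM.
  by rewrite -scalerA.
- move=> x; have [s Ss [a Wa]] := genV x; exists s, a => //.
  by exists 1; rewrite ?scale1r.
Qed.

(** Makes a locally nilpotent [b] nilpotent on a finitely generated module: the exponents of the
    generators add up. *)
Lemma span_uniformly_torsion b gens :
    (forall x : V, exists k, b ^+ k *: x = 0) ->
  exists k, forall x, span gens x -> b ^+ k *: x = 0.
Proof.
move=> tors; elim: gens => [|m gens [k Wk]] /=.
  by exists 0 => x ->; rewrite scaler0.
have [j mj] := tors m; exists (k + j)%N => x [a /Wk].
rewrite scalerBr => /eqP; rewrite subr_eq0 => /eqP Ex.
by rewrite addnC exprD -scalerA Ex !scalerA -mulrA mulrC -scalerA mj scaler0.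
Qed.

(** After inverting [b] and the positive integers there is a nonzero cyclic quotient generated by
    some [m]. Then [chi] is a point of its support, and [phi x] is [chi a / chi s] whenever [s *: x]
    equals [a *: m] in the quotient. *)
Lemma eigenfunctional (K : closedFieldType) gens b :
    [pchar K] =i pred0 -> separating K R -> (forall x, span gens x) ->
    (forall (x : V) n, x *+ n.+1 = 0 -> x = 0) ->
    (forall k, exists x : V, b ^+ k *: x != 0) ->
  exists (chi : {rmorphism R -> K}) (phi : V -> K),
    [/\ {morph phi : x y / x + y},
        forall a x, phi (a *: x) = chi a * phi x,
        chi b != 0 & exists m, phi m = 1].
Proof.
move=> K0 sepR genV tfV nnilb.
pose S : set R := [set s | exists n k, s = n.+1%:R * b ^+ k].
have S1 : S 1 by exists 0, 0; rewrite mulr1.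
have SM s t : S s -> S t -> S (s * t).
  move=> [n [k ->]] [j [l ->]]; exists (n.+1 * j.+1).-1%N, (k + l)%N.
  by rewrite prednK // natrM exprD mulrACA.
have [||m [W [subW satW nWm cycW]]] := cyclic_quotient S1 SM (gens := gens).
- by move=> x; exists 1; rewrite ?scale1r.
- move=> torsS.
  have [|k bk] := @span_uniformly_torsion b gens.
    move=> x; have [_ [n [k ->]] sx] := torsS x; exists k.
    by apply: (tfV _ n); rewrite -scaler_nat scalerA.
  by have [x /eqP[]] := nnilb k; apply: bk.
have [W0 WD WZ] := subW.
(* The annihilator of [m] modulo [W]; it misses [S] because [W] is saturated and omits [m]. *)
pose J : set R := [set a | W (a *: m)].
have [|s Ss|P [primeP sJP disjP]] := prime_avoiding S1 SM (J := J).
- split=> [|a c Wa Wc|a c Wc]; rewrite /J /= ?scale0r ?scalerDl -?scalerA //.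
    exact: WD.
  exact: WZ.
- by move/(satW _ _ Ss).
have [||chi chiP chib] := sepR _ primeP _ b.
- by move=> n; apply: disjP; exists n, 0; rewrite mulr1.
- by apply: disjP; exists 0, 1; rewrite mul1r.
have chiS s : S s -> chi s != 0.
  move=> [n [k ->]]; rewrite rmorphM rmorphXn rmorph_nat mulf_neq0 ?expf_neq0 //.
  by rewrite (pcharf0P K).1.
(* The value [chi a / chi s] depends on [x] alone: [t * a - s * c] annihilates [m] modulo [W], so
   [chi] kills it. *)
have chiE s a t c x : W (s *: x - a *: m) -> W (t *: x - c *: m) ->
    chi t * chi a = chi s * chi c.
  move=> Wa Wc; apply/eqP; rewrite -!rmorphM -subr_eq0 -rmorphB; apply/eqP.
  apply/chiP/sJP; rewrite /J /=.
  have -> : (t * a - s * c) *: m =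
      s *: (t *: x - c *: m) - t *: (s *: x - a *: m).
    rewrite scalerBl !scalerBr !scalerA (mulrC t s) opprB.
    by rewrite [RHS]addrC addrA subrK.
  by apply: submoduleB => //; apply: WZ.
have /choice[phi phiP] : forall x, exists v,
    forall s a, W (s *: x - a *: m) -> v * chi s = chi a.
  move=> x; have [s [a Ss Wa]] := cycW x; exists (chi a / chi s) => t c Wc.
  rewrite mulrAC [chi a * _]mulrC (chiE _ _ _ _ _ Wa Wc) mulrC mulKf //.
  exact: chiS.
exists chi, phi; split=> //.
- move=> x y; have [s [a Ss Wa]] := cycW x; have [t [c St Wc]] := cycW y.
  apply: (mulIf (chiS _ (SM _ _ Ss St))).
  have := phiP (x + y) (s * t) (t * a + s * c); rewrite rmorphD !rmorphM => ->.
    by rewrite -(phiP _ _ _ Wa) -(phiP _ _ _ Wc) 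
      mulrDl [chi t * _]mulrCA [chi s * (_ * _)]mulrCA (mulrC (chi t)).
  have := WD _ _ (WZ t _ Wa) (WZ s _ Wc).
  by rewrite !scalerBr !scalerA addrACA -opprD scalerDr scalerDl (mulrC t s).
- move=> c x; have [s [a Ss Wa]] := cycW x.
  apply: (mulIf (chiS _ Ss)); rewrite (phiP _ _ (c * a)) ?rmorphM.
    by rewrite -mulrA (phiP _ _ _ Wa).
  by rewrite scalerA mulrC -!scalerA -scalerBr; apply: WZ.
- by exists m; have := phiP m 1 1; rewrite subrr rmorph1 mulr1; apply.
Qed.

End Submodules.

(** * Polynomial rings acting through commuting operators *)

Section PolyModule.
Variables (R : comNzRingType) (V : lmodType R) (f : {linear V -> V}).
Implicit Types (p q : {poly R}) (x y : V).

Definition poly_act (p : {poly R}) (x : V) : V :=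
  \sum_(i < size p) p`_i *: iter i f x.

Lemma poly_act_wide p n x :
  (size p <= n)%N -> poly_act p x = \sum_(i < n) p`_i *: iter i f x.
Proof.
move=> le_pn; rewrite /poly_act (big_ord_widen n (fun i => p`_i *: iter i f x)) //.
rewrite big_mkcond; apply: eq_bigr => i _; case: ltnP => // le_pi.
by rewrite nth_default // scale0r.
Qed.

Lemma poly_actDl p q x : poly_act (p + q) x = poly_act p x + poly_act q x.
Proof.
rewrite (@poly_act_wide p (maxn (size p) (size q))) ?leq_maxl //.
rewrite (@poly_act_wide q (maxn (size p) (size q))) ?leq_maxr //.
rewrite (poly_act_wide _ (size_polyD p q)) -big_split.
by apply: eq_bigr => i _; rewrite coefD scalerDl.
Qed.

Lemma poly_actDr p x y : poly_act p (x + y) = poly_act p x + poly_act p y.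
Proof.
rewrite -big_split; apply: eq_bigr => i _ /=; rewrite -scalerDr; congr (_ *: _).
by elim: (i : nat) => //= j ->; rewrite raddfD.
Qed.

Lemma poly_actC a x : poly_act a%:P x = a *: x.
Proof.
by rewrite (@poly_act_wide _ 1) ?size_polyC_leq1 // big_ord1 coefC.
Qed.

Lemma poly_actZ c p x : poly_act (c *: p) x = c *: poly_act p x.
Proof.
rewrite (poly_act_wide _ (size_scale_leq c p)) scaler_sumr.
by apply: eq_bigr => i _; rewrite coefZ scalerA.
Qed.

Lemma poly_actMX p x : poly_act (p * 'X) x = poly_act p (f x).
Proof.
rewrite (@poly_act_wide _ (size p).+1); last first.
  have [->|p0] := eqVneq p 0; first by rewrite mul0r size_poly0.
  by rewrite size_mulX.
rewrite big_ord_recl coefMX scale0r add0r.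
by apply: eq_bigr => i _; rewrite coefMX -iterSr.
Qed.

Lemma poly_act_comm (g : {linear V -> V}) p x :
  (forall y, f (g y) = g (f y)) -> g (poly_act p x) = poly_act p (g x).
Proof.
move=> fg; rewrite raddf_sum; apply: eq_bigr => i _ /=; rewrite linearZ_LR /=.
by congr (_ *: _); elim: (i : nat) => //= j <-; rewrite fg.
Qed.

Lemma poly_actA p q x : poly_act p (poly_act q x) = poly_act (p * q) x.
Proof.
have act0 y : poly_act 0 y = 0 by rewrite /poly_act size_poly0 big_ord0.
elim/poly_ind: p x => [|p c IHp] x; first by rewrite mul0r !act0.
rewrite mulrDl mulrAC !poly_actDl !poly_actMX poly_actC.
by rewrite poly_act_comm // IHp mul_polyC poly_actZ.
Qed.

Lemma poly_act1 : left_id 1 poly_act.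
Proof. by move=> x; rewrite -polyC1 poly_actC scale1r. Qed.

Lemma poly_actDl_morph x : {morph poly_act^~ x : p q / p + q}.
Proof. by move=> p q; exact: poly_actDl. Qed.

End PolyModule.

(** Naming [f] in the type lets the structure over [{poly R}], with ['X] acting as [f], be
    inferred. *)
Definition poly_module (R : comNzRingType) (V : lmodType R) (f : {linear V -> V}) :
  Type := V.

HB.instance Definition _ (R : comNzRingType) (V : lmodType R)
  (f : {linear V -> V}) := GRing.Zmodule.on (poly_module f).
HB.instance Definition _ (R : comNzRingType) (V : lmodType R)
    (f : {linear V -> V}) :=
  GRing.Zmodule_isLmodule.Build {poly R} (poly_module f)
    (poly_actA f) (poly_act1 f) (@poly_actDr R V f) (@poly_actDl_morph R V f).

(** One variable is adjoined per operator of [s]; the other operators commute with it, so they stay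
    linear over [{poly R}]. The clause on scalars carries ['X] through the later extensions. *)
Lemma commuting_operators_ring (K : closedFieldType) (T : eqType) (s : seq T)
    (R : comNzRingType) (V : lmodType R) (op : T -> {linear V -> V}) :
    separating K R -> (forall t u x, op t (op u x) = op u (op t x)) ->
  exists (R' : comNzRingType) (V' : lmodType R') (iso : {additive V -> V'}),
    [/\ separating K R', bijective iso,
        forall r, exists r', forall x, iso (r *: x) = r' *: iso x &
        forall t, t \in s -> exists r', forall x, iso (op t x) = r' *: iso x].
Proof.
elim: s R V op => [|t s IHs] R V op sepR opC.
  by exists R, V, idfun; split=> //; [exists idfun | move=> r; exists r].
pose V1 : lmodType {poly R} := poly_module (op t).
have lin_op u : linear (op u : V1 -> V1).
  move=> p x y; rewrite raddfD; congr (_ + _).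
  by rewrite /GRing.scale /= poly_act_comm.
pose op1 u : {linear V1 -> V1} :=
  HB.pack (op u : V1 -> V1) (GRing.isLinear.Build _ _ _ _ _ (lin_op u)).
have [R' [V' [iso [sepR' bij isoR isoT]]]] := IHs _ V1 op1 (separating_poly sepR) opC.
exists R', V', iso; split=> //.
  move=> r; have [r' Er'] := isoR r%:P; exists r' => x; rewrite -Er'.
  by congr (iso _); rewrite /GRing.scale /= poly_actC.
move=> u; rewrite inE => /predU1P[->|]; last exact: isoT.
have [r' Er'] := isoR 'X; exists r' => x; rewrite -Er'; congr (iso _).
by rewrite -['X]mul1r [RHS]poly_actMX poly_act1.
Qed.

(** * Words in commuting operators *)

Section CommutingOperators.
Variables (T : eqType) (M : zmodType) (op : T -> {additive M -> M}).
Hypothesis opC : forall t u x, op t (op u x) = op u (op t x).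

(** For conjugation on the derived subgroup, this is a commutator with [t] written additively. *)
Definition diff t x := op t x - x.

Lemma diffB t : {morph diff t : x y / x - y}.
Proof. by move=> x y; rewrite /diff raddfB opprD addrACA opprD. Qed.

Lemma op_diff t u x : op t (diff u x) = diff u (op t x).
Proof. by rewrite /diff raddfB opC. Qed.

Lemma diffC t u x : diff t (diff u x) = diff u (diff t x).
Proof. by rewrite [in LHS]/diff op_diff -diffB. Qed.

Definition diffs (w : seq T) (x : M) := foldr diff x w.

Lemma diffsB w : {morph diffs w : x y / x - y}.
Proof. by move=> x y; elim: w => //= t w ->; rewrite diffB. Qed.

Lemma diffs0 w : diffs w 0 = 0.
Proof. by rewrite -[X in diffs w X](subrr 0) diffsB subrr. Qed.

Lemma op_diffs t w x : op t (diffs w x) = diffs w (op t x).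
Proof. by elim: w => //= u w <-; rewrite op_diff. Qed.

Lemma diff_diffs t w x : diff t (diffs w x) = diffs w (diff t x).
Proof. by elim: w => //= u w <-; rewrite diffC. Qed.

Lemma diffs_filter (a : pred T) w x :
  diffs w x = diffs (filter a w ++ filter (predC a) w) x.
Proof.
rewrite /diffs foldr_cat -/(diffs _ x) -/(diffs _ _).
elim: w => //= t w ->; case: (a t) => //=.
by rewrite -[foldr _ _ _]/(diffs _ _) diff_diffs.
Qed.

(** By pigeonhole, a long word contains [t] often enough to vanish, or else has many letters other
    than [t]; commutation groups the letters. *)
Lemma nilpotent_diffs (s : seq T) :
    (forall t, t \in s -> exists k, forall x, iter k (diff t) x = 0) ->
  exists L, forall w x, {subset w <= s} -> (L <= size w)%N -> diffs w x = 0.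
Proof.
elim: s => [_|t s IHs nil_s].
  by exists 1%N => -[//|u w] x /(_ u); rewrite mem_head => /(_ isT).
have [u us|L diffs_s] := IHs; first by apply: nil_s; rewrite inE us orbT.
have [k nil_t] := nil_s t (mem_head _ _).
exists (k + L)%N => w x ws le_w.
rewrite (diffs_filter (pred1 t)) /diffs foldr_cat -/(diffs _ x).
have [le_k|lt_k] := leqP k (count (pred1 t) w).
  have /all_pred1P -> : all (pred1 t) (filter (pred1 t) w) by exact: filter_all.
  rewrite size_filter -(subnK le_k); elim: (_ - k)%N => /= [|n ->]; last first.
    by rewrite /diff raddf0 subrr.
  suff foldr_nseq n y : foldr diff y (nseq n t) = iter n (diff t) y.
    by rewrite foldr_nseq nil_t.
  by elim: n => //= n ->.
rewrite [diffs _ x]diffs_s ?[foldr _ _ _]diffs0 //.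
  move=> u; rewrite mem_filter /= => /andP[ut /ws].
  by rewrite inE (negPf ut).
rewrite size_filter -(leq_add2l k) (leq_trans le_w) //.
by rewrite -(count_predC (pred1 t) w) leq_add2r ltnW.
Qed.

(** [M] is a module over Z, then over the ring built from the operators of [s]. The hypothesis on
    [W] says that [gens] spans it, and [eigenfunctional] applies to the scalar of [diff t0]. *)
Lemma common_eigenfunctional (K : closedFieldType) (s : seq T) (gens : seq M) t0 :
    [pchar K] =i pred0 -> (forall (x : M) n, x *+ n.+1 = 0 -> x = 0) ->
    (forall W : set M, W 0 -> (forall x y, W x -> W y -> W (x + y)) ->
      (forall x, W x -> W (- x)) ->
      (forall t x, t \in s -> W x -> W (op t x)) ->
      (forall x, x \in gens -> W x) -> forall x, W x) ->
    t0 \in s -> (forall k, exists x, iter k (diff t0) x != 0) ->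
  exists phi : M -> K,
    [/\ {morph phi : x y / x + y}, exists m, phi m = 1,
        forall t, t \in s -> exists c, forall x, phi (op t x) = c * phi x &
        exists2 c, c != 1 & forall x, phi (op t0 x) = c * phi x].
Proof.
move=> K0 tfM genM t0s nnil.
have lin_op t : linear (op t : zmodule M -> zmodule M).
  by move=> a x y; rewrite raddfD raddfMz.
pose opz t : {linear zmodule M -> zmodule M} :=
  HB.pack (op t : zmodule M -> zmodule M) (GRing.isLinear.Build _ _ _ _ _ (lin_op t)).
have [R [V [iso [sepR bij_iso _ isoT]]]] :=
  @commuting_operators_ring K T s _ _ opz (separating_int K0) opC.
have [osi isoK osiK] := bij_iso.
have [r0 r0E] := isoT _ t0s.
have isoB x : iso (diff t0 x) = (r0 - 1) *: iso x.
  by rewrite raddfB /= r0E scalerBl scale1r.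
have [||k|chi [phi [phiD phiZ chi_neq0 [m phim]]]] :=
    @eigenfunctional R V K [seq iso x | x <- gens] (r0 - 1) K0 sepR.
- move=> v; rewrite -[v]osiK; move: (osi v).
  have [W0 WD WZ] := span_submodule [seq iso x | x <- gens].
  apply: genM.
  + by rewrite raddf0.
  + by move=> x y Wx Wy; rewrite raddfD; apply: WD.
  + by move=> x Wx; rewrite raddfN -scaleN1r; apply: WZ.
  + by move=> t x /isoT[r rE] Wx; rewrite rE; apply: WZ.
  + by move=> x gx; apply: mem_span; apply: map_f.
- move=> v n; rewrite -[v]osiK -raddfMn -[RHS](raddf0 iso) -{1}(raddf0 iso).
  by move=> /(bij_inj bij_iso)/tfM ->.
- have [x nx] := nnil k; exists (iso x).
  suff <- : iso (iter k (diff t0) x) = (r0 - 1) ^+ k *: iso x.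
    by rewrite -(raddf0 iso) (inj_eq (bij_inj bij_iso)).
  by elim: k {nx} => [|k IHk]; rewrite ?scale1r //= isoB IHk scalerA exprS.
exists (phi \o iso); split.
- by move=> x y; rewrite /= raddfD phiD.
- by exists (osi m); rewrite /= osiK.
- by move=> t /isoT[r rE]; exists (chi r) => x; rewrite /= rE phiZ.
- exists (chi r0); last by move=> x; rewrite /= r0E phiZ.
  by move: chi_neq0; rewrite rmorphB rmorph1 subr_eq0.
Qed.

End CommutingOperators.

(** * The derived subgroup as a module *)

Local Open Scope group_scope.

Section Generation.
Variable G : groupType.
Implicit Types (A H : set G) (x y g h : G).

Lemma generated_min A H : is_subgroup H -> A `<=` H -> generated A `<=` H.
Proof. by move=> sgH AH x Ax; apply: Ax. Qed.

Lemma mem_generated A x : A x -> generated A x.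
Proof. by move=> Ax H [_]; apply. Qed.

Lemma derived_comm x y : @derived G [~ x, y].
Proof. by apply: mem_generated; exists x => //; exists y. Qed.

Lemma comm_mulg x y z : [~ x * y, z] = [~ x, z] ^ y * [~ y, z].
Proof. by rewrite /commg /conjg invgM !mulgA !mulgK. Qed.

Lemma comm_invg x y : [~ x^-1, y] = ([~ x, y] ^ x^-1)^-1.
Proof. by rewrite /commg /conjg !invgM !invgK !mulgA ?mulgK ?mulgVK. Qed.

(** All of [G] normalizes [H], so the elements commuting with a fixed [y] modulo [H] form a
    subgroup. This is used in each argument of the commutator in turn. *)
Lemma derived_sub_normal (S H : set G) :
    generated S = setT -> is_subgroup H ->
    (forall x g, S g -> H x -> H (x ^ g) /\ H (x ^ g^-1)) ->
    (forall a b, S a -> S b -> H [~ a, b]) ->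
  @derived G `<=` H.
Proof.
move=> genS [H1 HM HV] normS commS.
have sub_gen (A : set G) : is_subgroup A -> S `<=` A -> forall g, A g.
  by move=> sgA SA g; apply: (generated_min sgA SA); rewrite genS.
have normH x g : H x -> H (x ^ g).
  (* Conjugation by [g] and by [g^-1] are treated together, so that the condition is closed under
     inversion. *)
  move: x; apply: (proj1 (A := forall x, H x -> H (x ^ g))
                         (B := forall x, H x -> H (x ^ g^-1))).
  apply: (sub_gen [set g | _ /\ _]) g => [|g Sg]; last first.
    by split=> x /(normS _ _ Sg)[].
  split=> [|g h [Hg Hgi] [Hh Hhi]|g [Hg Hgi]] /=.
  - by rewrite invg1; split=> x; rewrite conjg1.
  - by rewrite invgM; split=> x Hx; rewrite conjgM; [apply/Hh/Hg|apply/Hgi/Hhi].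
  - by rewrite invgK; split.
have comm_subgroup y : is_subgroup [set x | H [~ x, y]].
  split=> [|a b Ha Hb|a Ha] /=; first by rewrite comm1g.
    by rewrite comm_mulg; apply: (HM) => //; apply: normH.
  by rewrite comm_invg; apply/HV/normH.
have commS' g s : S s -> H [~ g, s].
  by move=> Ss; apply: (sub_gen _ (comm_subgroup s)) => a Sa; apply: commS.
apply: generated_min; first by split.
move=> _ [x _ [y _ <-]]; rewrite -[[~ x, y]]invgK invgR; apply: (HV).
apply: (sub_gen _ (comm_subgroup x)) => s Ss /=.
by rewrite -[[~ s, x]]invgK invgR; apply/HV/commS'.
Qed.

End Generation.

(* The derived subgroup written additively; [metaG] makes it commutative. *)
Definition derived_module (G : groupType) (metaG : metabelian G) : Type :=
  {x : G | `[< @derived G x >]}.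

Section DerivedModule.
Variables (G : groupType) (metaG : metabelian G).
Local Notation M := (derived_module metaG).

HB.instance Definition _ := Choice.on M.

Definition dval (x : M) : G := val x.
Definition dsub x (Dx : @derived G x) : M := exist _ x (asboolT Dx).

Lemma dval_derived x : @derived G (dval x).
Proof. exact/asboolP/(valP x). Qed.

Lemma dval_inj : injective dval.
Proof. exact: val_inj. Qed.

Let subG := generated_subgroup [set [~ a, b] | a in [set: G] & b in [set: G]].

Lemma derived1 : @derived G 1. Proof. by have [] := subG. Qed.
Lemma derivedM x y : @derived G x -> @derived G y -> @derived G (x * y).
Proof. by have [_ + _] := subG; apply. Qed.
Lemma derivedV x : @derived G x -> @derived G x^-1.
Proof. by have [_ _] := subG; apply. Qed.

Definition dadd (x y : M) : M := dsub (derivedM (dval_derived x) (dval_derived y)).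
Definition dopp (x : M) : M := dsub (derivedV (dval_derived x)).
Definition dzero : M := dsub derived1.

Lemma daddC : commutative dadd.
Proof.
move=> x y; apply: dval_inj => /=; apply/commgP/eqP.
suff: derived2 [~ dval x, dval y] by rewrite metaG.
by apply: mem_generated; exists (dval x); [|exists (dval y)] => //; apply: dval_derived.
Qed.

Lemma daddA : associative dadd.
Proof. by move=> x y z; apply: dval_inj; rewrite /= /dval /= mulgA. Qed.

Lemma dadd0 : left_id dzero dadd.
Proof. by move=> x; apply: dval_inj; rewrite /= /dval /= mul1g. Qed.

Lemma daddN : left_inverse dzero dopp dadd.
Proof. by move=> x; apply: dval_inj; rewrite /= /dval /= mulVg. Qed.

HB.instance Definition _ := GRing.isZmodule.Build M daddA daddC dadd0 daddN.

Lemma dvalD x y : dval (x + y)%R = dval x * dval y. Proof. by []. Qed.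
Lemma dvalN x : dval (- x)%R = (dval x)^-1. Proof. by []. Qed.

Lemma dvalMn x n : dval (x *+ n)%R = dval x ^+ n.
Proof. by elim: n => // n IHn; rewrite mulrS expgS dvalD IHn. Qed.

(* The left action of [g] on [G'], [x |-> g x g^-1]. *)
Definition dact (g : G) (x : M) : M :=
  dsub (commutatorTT_normal g^-1 (dval_derived x)).

Lemma dval_act g x : dval (dact g x) = dval x ^ g^-1. Proof. by []. Qed.

Lemma dact_is_additive g : zmod_morphism (dact g).
Proof.
by move=> x y; apply: dval_inj; rewrite !(dval_act, dvalD, dvalN) conjMg conjVg.
Qed.

HB.instance Definition _ g := GRing.isZmodMorphism.Build M M (dact g) (dact_is_additive g).

Lemma dactM g h x : dact (g * h) x = dact g (dact h x).
Proof. by apply: dval_inj; rewrite !dval_act invgM conjgM. Qed.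

Lemma dact1 x : dact 1 x = x.
Proof. by apply: dval_inj; rewrite !dval_act invg1 conjg1. Qed.

Lemma dact_derived g x : @derived G g -> dact g x = x.
Proof.
move=> Dg; apply: dval_inj; rewrite dval_act.
have /commgP/eqP := congr1 dval (daddC (dsub (derivedV Dg)) x).
by move=> cgx; apply/conjg_fixP/eqP; rewrite -invgR cgx invg1.
Qed.

(** The two products differ by an element of G', which acts trivially because G' is abelian. *)
Lemma dactC g h x : dact g (dact h x) = dact h (dact g x).
Proof.
by rewrite -!dactM (commgCV g h) [LHS]dactM (dact_derived _ (derived_comm _ _)).
Qed.

(** Expresses that the commutators of elements of [S] generate G' as a module over [G]. *)
Lemma derived_module_ind (S : set G) (W : set M) :
    generated S = setT -> W 0%R -> (forall x y, W x -> W y -> W (x + y)%R) ->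
    (forall x, W x -> W (- x)%R) ->
    (forall g x, S g -> W x -> W (dact g x) /\ W (dact g^-1 x)) ->
    (forall a b, S a -> S b -> W (dsub (derived_comm a b))) ->
  forall x, W x.
Proof.
move=> genS W0 WD WN WS Wcomm x.
pose H : set G := [set y | exists2 m, W m & dval m = y].
have [m Wm /dval_inj<-//] : H (dval x).
apply: (@derived_sub_normal _ S H genS) (dval_derived x).
- split; first by exists 0%R.
    by move=> _ _ [a Wa <-] [b Wb <-]; exists (a + b)%R; first exact: WD.
  by move=> _ [a Wa <-]; exists (- a)%R; first exact: WN.
- move=> _ g Sg [a Wa <-]; have [Wga Wgia] := WS g a Sg Wa.
  by split; [exists (dact g^-1 a) | exists (dact g a)] => //; rewrite dval_act ?invgK.
- by move=> a b Sa Sb; exists (dsub (derived_comm a b)); first exact: Wcomm.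
Qed.

End DerivedModule.

Section NilpotencyCriterion.
Variables (G : groupType) (metaG : metabelian G).
Local Notation M := (derived_module metaG).

Definition dop (g : G) : {additive M -> M} := dact g.

Lemma dopC g h x : dop g (dop h x) = dop h (dop g x).
Proof. exact: dactC. Qed.

(* Elements of [G'] killed by words of length [L - n] contain the [n+1]-st term of
   the lower central series. *)
Lemma nilpotent_of_diffs (S : set G) (L : nat) :
    generated S = setT ->
    (forall (w : seq G) x, (forall g, g \in w -> S g) -> (L <= size w)%N ->
      diffs dop w x = 0%R) ->
  nilpotent G.
Proof.
move=> genS diffs0L.
pose E n : set M := [set m | forall w : seq G, (forall g, g \in w -> S g) ->
  (size w + n)%N = L -> diffs dop w m = 0%R].
have EB n a b : E n a -> E n b -> E n (a - b)%R.
  by move=> Ea Eb w wS sw; rewrite diffsB Ea ?Eb ?subrr.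
have E0 n : E n 0%R by move=> w _ _; exact: diffs0.
have EN n a : E n a -> E n (- a)%R by rewrite -sub0r; exact: EB.
have ED n a b : E n a -> E n b -> E n (a + b)%R.
  by move=> Ea /EN Eb; rewrite -[b]opprK; exact: EB.
have Eact n g a : E n a -> E n (dact g a).
  by move=> Ea w wS sw; rewrite -(op_diffs dopC) Ea // raddf0.
(* For [g] in [S] this appends a letter to the word. The rest follows from gh - 1 = (g - 1)h + (h -
   1) and g^-1 - 1 = -(g - 1)g^-1. *)
have Ediff n g : (n < L)%N -> forall a, E n a -> E n.+1 (dact g a - a)%R.
  move=> ltnL; have : [set: G] g by []; rewrite -genS; move: g.
  apply: generated_min => [|g Sg a Ea w wS sw] /=; last first.
    rewrite -[LHS]/(diffs dop w (diff dop g a)) -[LHS]/(foldr _ _ _) -foldr_rcons.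
    apply: Ea; last by rewrite size_rcons addSnnS.
    by move=> h; rewrite mem_rcons inE => /predU1P[->|/wS].
  split=> [a Ea|g h Hg Hh a Ea|g Hg a Ea] /=.
  - by rewrite dact1 subrr.
  - rewrite dactM -[dact g _](subrK (dact h a)) -addrA.
    by apply: ED; [apply/Hg/Eact | apply: Hh].
  - rewrite -{2}[a]dact1 -(mulgV g) dactM -opprB.
    by apply/EN/Hg/Eact.
have lc_sub n : (n <= L)%N ->
    lower_central n.+1 `<=` [set x | exists2 m, E n m & dval m = x].
  elim: n => [_ x Dx|n IHn ltnL].
    exists (dsub metaG Dx) => // w wS sw; apply: diffs0L => //.
    by rewrite -sw addn0.
  apply: generated_min.
    split; first by exists 0%R.
      by move=> _ _ [a Ea <-] [b Eb <-]; exists (a + b)%R; first exact: ED.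
    by move=> _ [a Ea <-]; exists (- a)%R; first exact: EN.
  move=> _ [y /(IHn (ltnW ltnL))[m Em <-] [h _ <-]].
  (* The commutator of x and [h] is x^-1 x^h, and x^h is the left action of [h^-1]. *)
  exists (dact h^-1 m - m)%R; first exact: Ediff.
  by rewrite addrC dvalD dvalN dval_act invgK.
exists L.+1; apply/seteqP; split=> [x|x ->]; last first.
  by have [] := generated_subgroup [set [~ a, b] | a in @lower_central G L & b in setT].
(* Elements of [E L] are killed by the empty word, so they are zero. *)
move=> /(lc_sub L (leqnn L))[m Em <-].
by have /= -> := Em [::] (fun _ => ltac:(done)) (add0n L).
Qed.

End NilpotencyCriterion.

(** * Characters and cocycles *)

Section Characters.
Variables (G : groupType) (K : fieldType).

Lemma character1 (rho : character G K) : val (rho 1) = 1%R.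
Proof.
apply: (mulfI (valP (rho 1))).
by rewrite mulr1 -[LHS]/(val (rho 1 * rho 1)) -gmulfM mulg1.
Qed.

Lemma characterM (rho : character G K) g h :
  val (rho (g * h)) = (val (rho g) * val (rho h))%R.
Proof. by rewrite gmulfM. Qed.

Lemma characterV (rho : character G K) g : val (rho g^-1) = (val (rho g))^-1%R.
Proof.
by apply: (mulfI (valP (rho g))); rewrite -characterM mulgV character1 divff ?(valP (rho g)).
Qed.

Lemma character_derived (rho : character G K) x : derived x -> val (rho x) = 1%R.
Proof.
apply: (@generated_min G _ [set x | val (rho x) = 1%R]).
  split=> [|a b|a]; rewrite /mkset; first exact: character1.
    by rewrite characterM => -> ->; rewrite mulr1.
  by rewrite characterV => ->; rewrite invr1.
move=> _ [a _ [b _ <-]].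
rewrite /mkset /commg /conjg !characterM !characterV mulrCA !mulrA mulfVK ?(valP (rho a)) //.
by rewrite mulVf ?(valP (rho b)).
Qed.

Lemma character_ext (rho sigma : character G K) : rho =1 sigma -> rho = sigma.
Proof.
case: rho sigma => f [[fM]] [g [[gM]]] /= /funext E; subst g.
by rewrite (Prop_irrelevance fM gM).
Qed.

Lemma quotient_module_eq0P (V : lmodType K) (W : submodClosed V) v :
  reflect (\pi_(quotient_module W)%qT v = 0%R) (v \in W).
Proof.
have pi0 : \pi_(quotient_module W)%qT 0%R = 0%R.
  apply: (addrI (\pi_(quotient_module W)%qT 0%R)).
  by rewrite -pi_quotient_addP !addr0.
by rewrite -pi0 -{2}[v]subr0; apply: quotient_module_eqP.
Qed.

Lemma charvar1P (rho : character G K) : charvar1 G K 1 rho <->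
  exists2 f : G -> K,
    forall g h, f (g * h) = (f g + val (rho g) * f h)%R &
    ~ exists z, forall g, f g = (val (rho g) * z - z)%R.
Proof.
split=> [[v v_free]|[f fM f_nb]].
  pose u := v ord0; have u_neq0 : u <> 0%R.
    move=> u0; have := v_free (fun=> 1%R); rewrite big_ord1 -/u u0 scaler0.
    by move=> /(_ erefl ord0)/eqP; rewrite oner_eq0.
  pose f : Z1 rho := repr u; exists (val f); first by have /asboolP := valP f.
  move=> fB; apply: u_neq0; rewrite -[u]reprK.
  by apply/quotient_module_eq0P/asboolP.
have fZ : f \in cocycle rho by apply/asboolP.
pose F : Z1 rho := exist _ f fZ; pose u : H1 rho := \pi_(H1 rho)%qT F.
exists (fun=> u) => a; rewrite big_ord1 => au0 i; rewrite (ord1 i).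
apply: contrapT => /eqP a0; apply: f_nb.
have u0 : u = 0%R by rewrite -[u](scalerK a0) au0 scaler0.
by have /quotient_module_eq0P/asboolP := u0.
Qed.

End Characters.

(** * Eigencharacters on G' and the two implications *)

Lemma eigencharacter (K : closedFieldType) (G : groupType) (metaG : metabelian G) :
    [pchar K] =i pred0 -> finitely_generated G -> torsion_free G -> ~ nilpotent G ->
  exists (rho : character G K) (phi : derived_module metaG -> K),
    [/\ {morph phi : x y / (x + y)%R},
        forall g x, phi (dact g x) = (val (rho g) * phi x)%R,
        exists m, phi m = 1%R & exists g, val (rho g) <> 1%R].
Proof.
move=> K0 [S /finite_seqP[s0 ->] genS] tfG nnilG.
have opC := dopC (metaG := metaG).
(* Otherwise all long words in the generators vanish on G', and [G] is nilpotent. *)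
have [t0 t0s nnil] : exists2 t, t \in s0 &
    forall k, exists x, iter k (diff (dop metaG) t) x != 0%R.
  apply: contrapT => /forall2NP all_nil; apply: nnilG.
  have [t ts|L diffs0] := @nilpotent_diffs G _ (dop metaG) opC s0.
    have [//|/existsNP[k nk]] := all_nil t.
    by exists k => x; apply: contrapT => /eqP nx; apply: nk; exists x.
  exact: nilpotent_of_diffs genS diffs0.
(* Inverses are included so that stability under [s] is stability under all of [G]. *)
pose s := s0 ++ [seq g^-1 | g <- s0].
pose gens := [seq dsub metaG (derived_comm a b) | a <- s0, b <- s0].
have [|W W0 WD WN Wact Wgens|||phi [phiD [m phim] phi_s [c0 c0_neq1 phi_t0]]] :=
    @common_eigenfunctional G _ (dop metaG) opC K s gens t0 K0.
- move=> x n /(congr1 (@dval _ _)); rewrite dvalMn => /tfG x1.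
  by apply: dval_inj; exact: x1.
- apply: (derived_module_ind genS) => // [g x|a b] /= => [gs Wx|aS bS].
    split; apply: (Wact _ x) => //; rewrite mem_cat ?gs //.
    by rewrite map_f ?orbT.
  by apply: Wgens; apply: allpairs_f.
- by rewrite mem_cat t0s.
- exact: nnil.
(* The elements acting through a scalar form a subgroup that contains the generators. *)
have /choice[c cE] : forall g, exists c, forall x, phi (dact g x) = (c * phi x)%R.
  move=> g; have : [set: G] g by []; rewrite -genS; move: g.
  apply: generated_min => [|g gs]; last by apply: phi_s; rewrite mem_cat gs.
  split=> [|g h [a aE] [b bE]|g [a aE]].
  - by exists 1%R => x; rewrite dact1 mul1r.
  - by exists (a * b)%R => x; rewrite dactM aE bE mulrA.
  - exists a^-1%R => x; have a_neq0 : a != 0%R.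
      have := aE (dact g^-1 m); rewrite -dactM mulgV dact1 phim => E.
      by apply/eqP => a0; move/eqP: E; rewrite a0 mul0r oner_eq0.
    by apply: (mulfI a_neq0); rewrite -aE -dactM mulgV dact1 mulVKf.
(* A scalar is determined by its effect on [m], where [phi] is 1. *)
have cM g h : c (g * h) = (c g * c h)%R.
  by rewrite -[LHS]mulr1 -[RHS]mulr1 -phim -cE dactM !cE mulrA.
have c1 : c 1 = 1%R by rewrite -[LHS]mulr1 -phim -cE dact1.
have c_neq0 g : c g != 0%R.
  apply/eqP => cg0; have := cM g g^-1; rewrite mulgV c1 cg0 mul0r.
  by move/eqP; rewrite oner_eq0.
pose rho_fun g : mulgroup K := Sub (c g) (c_neq0 g).
have rhoM : {morph rho_fun : x y / x * y} by move=> g h; apply: val_inj; rewrite /= cM.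
pose rho : character G K := HB.pack rho_fun (isMultiplicative.Build _ _ _ rhoM).
exists rho, phi; split=> //; first by exists m.
exists t0 => /= ct0; move/eqP: c0_neq1; apply.
by rewrite -[LHS]mulr1 -[RHS]ct0 -[RHS]mulr1 -phim -phi_t0 cE.
Qed.

Lemma nilpotent_charvar1 (K : fieldType) (G : groupType) :
  nilpotent G -> charvar1 G K 1 `<=` [set trivial_character G K].
Proof.
move=> [n lcn] rho /charvar1P[f fM f_nb]; apply: contrapT => rho_neq1; apply: f_nb.
have [g0 rg0] : exists g, val (rho g) != 1%R.
  apply: contrapT => /forallNP rho1; apply: rho_neq1; apply: character_ext => g.
  by apply: val_inj; apply/eqP; rewrite -[_ == _]negbK; apply/negP/rho1.
(* Expanding [f] on xg = g x^g, with [rho] trivial at [x], gives f(x^g) = rho(g)^-1 f(x); then x^g =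
   x [x, g]. *)
have f_comm x g : derived x -> f [~ x, g] = (((val (rho g))^-1 - 1) * f x)%R.
  move=> Dx; have := fM g (x ^ g); rewrite -conjgC fM character_derived // mul1r.
  rewrite addrC => /addrI fx; have := fM x [~ x, g].
  rewrite commgEl mulVKg -commgEl character_derived // mul1r => fxg.
  rewrite mulrBl mul1r [in X in (X - _)%R]fx mulKf ?(valP (rho g)) //.
  by rewrite fxg addrC addKr.
have lc_derived k : @lower_central G k.+1 `<=` @derived G.
  apply: generated_min; first exact: generated_subgroup.
  by move=> _ [x _ [y _ <-]]; exact: derived_comm.
have f_lc k : (forall x, lower_central k.+1 x -> f x = 0%R) ->
    forall x, derived x -> f x = 0%R.
  elim: k => // k IHk fk; apply: IHk => x lcx.
  have := f_comm x g0 (lc_derived _ _ lcx); rewrite fk.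
    move/esym/eqP; rewrite mulf_eq0 subr_eq0 => /orP[/eqP rV|/eqP//].
    by move: rg0; rewrite -[val _]invrK rV invr1 eqxx.
  by apply: mem_generated; exists x => //; exists g0.
have f1 : f 1 = 0%R.
  have := fM 1 1; rewrite mulg1 character1 mul1r => /eqP.
  by rewrite -subr_eq0 opprD addrA subrr sub0r oppr_eq0 => /eqP.
have f_derived : forall x, derived x -> f x = 0%R.
  (* [f_lc] starts from the term of index [n.+1], which is trivial because the term of index [n]
     is. *)
  apply: (f_lc n) => x; rewrite /lower_central iterS -/(lower_central n) lcn => lcx.
  suff -> : x = 1 by [].
  move: x lcx; apply: generated_min => [|_ [_ -> [y _ <-]]]; last by rewrite comm1g.
  split=> [//|_ _ -> ->|_ ->]; first by rewrite /= mulg1.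
  by rewrite /= invg1.
(* The value forced by the coboundary equation at [g0]. It works for every [g] because [f] agrees on
   g g0 and g0 g, which differ by a commutator. *)
exists (f g0 / (val (rho g0) - 1))%R => g.
have rg0' : (val (rho g0) - 1 != 0)%R by rewrite subr_eq0.
apply: (mulIf rg0'); rewrite -[X in (_ * _ - X)%R]mul1r -mulrBl -mulrA divfK //.
have := fM g g0; rewrite commgC fM (f_derived _ (derived_comm _ _)) mulr0 addr0 fM => E.
apply/eqP; rewrite mulrBr mulr1 mulrBl mul1r [(f g * _)%R]mulrC.
by rewrite subr_eq addrAC eq_sym subr_eq [X in X == _]addrC -E addrC.
Qed.

Lemma charvar1_nilpotent (K : closedFieldType) (G : groupType) :
    [pchar K] =i pred0 -> finitely_generated G -> torsion_free G -> metabelian G ->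
  charvar1 G K 1 `<=` [set trivial_character G K] -> nilpotent G.
Proof.
move=> K0 fgG tfG metaG sub1; apply: contrapT => nnilG.
have [rho [phi [phiD phi_act [m phim] [g0 rg0]]]] := eigencharacter metaG K0 fgG tfG nnilG.
apply: (rg0); have -> // : rho = trivial_character G K.
apply: sub1; apply/charvar1P.
(* [[~ g0^-1, g^-1]] is g0 g g0^-1 g^-1. Writing it c(g), the cocycle rule comes from c(gh) = c(g)
   (g c(h) g^-1). *)
exists (fun g => phi (dsub metaG (derived_comm g0^-1 g^-1))) => [g h|[z zE]].
  rewrite -phi_act -phiD; congr phi; apply: dval_inj; rewrite dvalD dval_act /=.
  by rewrite /dval /= /commg /conjg !invgM !invgK !mulgA !mulgVK.
apply: rg0.
(* On G' a coboundary vanishes, whereas this cocycle takes the value rho(g0) - 1 at [m]. *)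
have := zE (dval m); rewrite character_derived ?mul1r ?subrr; last exact: dval_derived.
have -> : dsub metaG (derived_comm g0^-1 (dval m)^-1) = (dact g0 m - m)%R.
  by apply: dval_inj; rewrite dvalD dvalN dval_act /dval /= /commg /conjg !invgK !mulgA.
have phiN x : phi (- x)%R = (- phi x)%R.
  have phi0 : phi 0%R = 0%R by apply: (addrI (phi 0%R)); rewrite -phiD !addr0.
  by apply: (addrI (phi x)); rewrite -phiD !subrr.
rewrite phiD phiN phi_act phim mulr1 => /eqP.
by rewrite subr_eq0 => /eqP.
Qed.

Local Open Scope complex_scope.

Theorem theorem1p2 (R : realType) (G : groupType)
    (fgG : finitely_generated G) (tfG : torsion_free G) (metaG : metabelian G)
    (tfGab : torsion_free (abelianization G)) :
  nilpotent G <-> charvar1 G R[i] 1 `<=` [set trivial_character G R[i]].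
Proof.
split; first exact: nilpotent_charvar1.
by apply: charvar1_nilpotent => //; exact: Num.Theory.pchar_num.
Qed.
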